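(* Let $A=\mathbb{R}$, $\hat A=\{a_1,\dots,a_k\}\subset\mathbb{R}$ finite, and let $\rho:A\times\hat A\to[0,M]$ ($M<\infty$) be a (measurable) bounded distortion function with $\sup_{x\in A}\min_{y\in\hat A}\rho(x,y)=0$. Let $P$ be a Borel probability measure on $\mathbb{R}$ with $D_{\max}=\min_{y\in\hat A}E_P[\rho(X,y)]>0$, and suppose there is a nonempty open interval $I\subset\mathbb{R}$ on which $P$ has an absolutely continuous component (with respect to Lebesgue measure) with density $g$ satisfying $g(x)>0$ for $x\in I$. Write $r_j(x)=\rho(x,a_j)$ for $1\le j\le k$ and $r_0(x)\equiv 0$, and assume that each $r_j$ is continuous on $I$. Let $X_1\sim P$, and for $D\in(0,D_{\max})$ let $f=f_D:A\to\mathbb{R}$ be the function defined in the context. Suppose that the rate-distortion function $R(D)$ is differentiable and strictly convex on $(0,D_{\max})$, and that either one of the following two conditions holds: (a) There exist distinct points $x_0,x_1,\dots,x_k\in I$ such that, for all $0\le i\ne j\le k$ with $j\ne 0$, $r_j(x_j)>r_j(x_i)$. (b) There exist distinct points $x_0,x_1,\dots,x_k\in I$ such that, for every permutation $\pi$ of $\{0,1,\dots,k\}$ other than the identity, $$\sum_{j=0}^k r_j(x_j)\ne\sum_{j=0}^k r_j(x_{\pi(j)}).$$ Then there are at most finitely many $D\in(0,D_{\max})$ such that $f_D(X_1)=0$ with probability one.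
   Context: $\log$ is to base 2 and $\log_e$ is the natural logarithm. For a probability mass function $Q$ on $\hat A$ and $D\ge 0$ let $$R(P,Q,D)=\inf_{(X,Z)}\big[I(X;Z)+H(Q_Z\|Q)\big],$$ where the infimum is over jointly distributed $(X,Z)$ with values in $A\times\hat A$ such that $X$ has distribution $P$ and $E[\rho(X,Z)]\le D$; $Q_Z$ is the distribution of $Z$, $I(X;Z)$ is mutual information in bits, and $H(R\|Q)=\sum_{a}R(a)\log[R(a)/Q(a)]$ is relative entropy in bits. The rate-distortion function is $R(D)=\inf_{(X,Y)} I(X;Y)$, the infimum being over jointly distributed $(X,Y)$ in $A\times\hat A$ with $X\sim P$ and $E[\rho(X,Y)]\le D$; thus $R(D)=\inf_Q R(P,Q,D)$, the infimum being over all probability mass functions $Q$ on $\hat A$. For $\lambda\le 0$ let $\Lambda_{P,Q}(\lambda)=E_P\big[\log_e E_Q\big(e^{\lambda\rho(X,Y)}\big)\big]$, where $X\sim P$ and $Y\sim Q$ are independent and the inner expectation is over $Y$ only; let $\Lambda^*_{P,Q}(D)=\sup_{\lambda\le 0}[\lambda D-\Lambda_{P,Q}(\lambda)]$. Known facts used to define $f$: for every $D\in(0,D_{\max})$ there is a $Q^*$ with $R(P,Q^*,D)=R(D)$, and for such a $Q^*$ there is a unique $\lambda^*<0$ with $\Lambda'_{P,Q^*}(\lambda^* )=D$; it satisfies $\lambda^*D-\Lambda_{P,Q^*}(\lambda^* )=\Lambda^*_{P,Q^*}(D)=(\log_e 2)R(P,Q^*,D)=(\log_e 2)R(D)$. For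 each $D\in(0,D_{\max})$ choose such $Q^*$ and $\lambda^*$ (depending on $D$) and define, for $x\in A$, $$f(x)=f_D(x)=(\log e)\Big[\lambda^*D-\log_e E_{Q^*}\big(e^{\lambda^*\rho(x,Y)}\big)\Big]-R(D),\qquad Y\sim Q^*.$$ *)

(* Defs.v *)
From HB Require Import structures.
From mathcomp Require Import all_boot all_order all_fingroup all_algebra.
From mathcomp Require Import all_classical all_reals all_analysis.

Set Implicit Arguments.
Unset Strict Implicit.
Unset Printing Implicit Defensive.

Import Order.TTheory GRing.Theory Num.Def Num.Theory.
Import numFieldNormedType.Exports.

Local Open Scope classical_set_scope.
Local Open Scope ring_scope.
Local Open Scope charge_scope.

Definition log2 {R : realType} (x : R) : R := ln x / ln 2.

(* When [mu `<< nu] the Radon-Nikodym derivative is finite everywhere, so [fine]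
   is harmless; [mu] does not charge the points where it is [<= 0]. *)
Definition relative_entropy {d} {T : measurableType d} {R : realType}
    (mu : probability T R) (nu : {sigma_finite_measure set T -> \bar R}) : \bar R :=
  if pselect (mu `<< nu) then
    (\int[mu]_x (log2 (fine (('d (charge_of_finite_measure mu) '/d nu) x)))%:E)%E
  else +oo%E.

Section projections_mfun.
Context {d1 d2} {T1 : measurableType d1} {T2 : measurableType d2}.

HB.instance Definition _ :=
  isMeasurableFun.Build _ _ (T1 * T2)%type T1 (@fst T1 T2) measurable_fst.
HB.instance Definition _ :=
  isMeasurableFun.Build _ _ (T1 * T2)%type T2 (@snd T1 T2) measurable_snd.

End projections_mfun.

(* [product_subprobability (m1, m2)] is the product measure [m1 \x m2], here of
   the two marginals of the joint law [W]. *)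
Definition mutual_information {d1 d2} {T1 : measurableType d1}
    {T2 : measurableType d2} {R : realType}
    (W : probability (T1 * T2)%type R) : \bar R :=
  relative_entropy W
    (product_subprobability
       (distribution W (@fst T1 T2) : subprobability T1 R,
        distribution W (@snd T1 T2) : subprobability T2 R)).

Section rate_distortion.
Context {R : realType} {k : nat}.
Local Notation RR := (measurableTypeR R).

Implicit Types (P : probability RR R) (W : probability (RR * RR)%type R).
(* The reproduction alphabet is [range a]; a function [Q : 'I_k -> R] stands for
   the function [a j |-> Q j] on it, and [rho x y] matters only for [y] in
   [range a]. *)
Implicit Types (a Q S : 'I_k -> R) (rho : R -> R -> R) (D lam : R).

Definition is_pmf Q := (forall j, 0 <= Q j) /\ \sum_j Q j = 1.

Definition pmf_relative_entropy S Q : \bar R :=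
  if [exists j, (S j != 0) && (Q j == 0)] then +oo%E
  else (\sum_j S j * log2 (S j / Q j))%:E.

(* Joint laws of pairs (X, Z) with X ~ P, Z in [range a] and
   E[rho(X, Z)] <= D. *)
Definition admissible P a rho D : set (probability (RR * RR)%type R) :=
  [set W | [/\ forall B : set RR, measurable B -> W (fst @^-1` B) = P B,
               W [set z | range a z.2] = 1%E &
               (\int[W]_(z in [set z | range a z.2]) (rho z.1 z.2)%:E
                  <= D%:E)%E]].

Definition pmf_snd a W : 'I_k -> R := fun j => fine (W [set z | z.2 = a j]).

Definition rate P a rho Q D : \bar R :=
  ereal_inf [set (mutual_information W +
                  pmf_relative_entropy (pmf_snd a W) Q)%E
            | W in admissible P a rho D].

Definition rate_distortion P a rho D : \bar R :=
  ereal_inf [set mutual_information W | W in admissible P a rho D].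

(* Real-valued version: once [admissible P a rho D] is nonempty, the infimum
   lies in [0, log2 k]. *)
Definition RD P a rho D : R := fine (rate_distortion P a rho D).

(* Infima over the finite index set ['I_k], hence minima. *)
Definition Dmax P a rho : R :=
  inf [set \int[P]_x rho x (a j) | j in [set: 'I_k]].

Definition min_distortion a rho (x : R) : R :=
  inf [set rho x (a j) | j in [set: 'I_k]].

Definition mgf a rho Q lam (x : R) : R :=
  \sum_j Q j * expR (lam * rho x (a j)).

Definition Lambda P a rho Q lam : R := \int[P]_x ln (mgf a rho Q lam x).

(* [Q] and [lam] may serve as Q* and lambda* at distortion level [D]. *)
Definition optimal_pair P a rho D Q lam :=
  [/\ is_pmf Q, rate P a rho Q D = rate_distortion P a rho D, lam < 0 &
      is_derive lam 1 (Lambda P a rho Q) D].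

Definition f_D P a rho Q lam D (x : R) : R :=
  log2 (expR 1) * (lam * D - ln (mgf a rho Q lam x)) - RD P a rho D.

(* r_0 = 0, and r_(j+1) = rho(., a_j), the points being numbered from 0. *)
Definition r_ a rho (j : 'I_k.+1) (x : R) : R :=
  if unlift ord0 j is Some i then rho x (a i) else 0.

(* On [I], [P] is the measure with density [g] plus some other measure [nu],
   which need not be singular. *)
Definition ac_component P (I : set R) (g : R -> R) :=
  measurable_fun (I : set RR) (g : RR -> RR) /\
  exists nu : {measure set RR -> \bar R}, forall B : set RR,
    measurable B -> B `<=` I ->
    P B = (\int[lebesgue_measure]_(x in B) (g x)%:E + nu B)%E.

Definition strictly_convex_on (E : set R) (h : R -> R) :=
  forall x y t, E x -> E y -> x != y -> 0 < t < 1 ->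
    h (t * x + (1 - t) * y) < t * h x + (1 - t) * h y.

End rate_distortion.

(* Main.v *)
Require Import Defs.
From HB Require Import structures.
From mathcomp Require Import all_boot all_order all_fingroup all_algebra.
From mathcomp Require Import all_classical all_reals all_analysis.
From mathcomp Require Import measurable_realfun ring lra.

Set Implicit Arguments.
Unset Strict Implicit.
Unset Printing Implicit Defensive.

Import Order.TTheory GRing.Theory Num.Def Num.Theory.
Import numFieldNormedType.Exports.

Local Open Scope classical_set_scope.
Local Open Scope ring_scope.
Local Open Scope charge_scope.

(* Write Q, l for the optimal pair at the level D. If f_D(X_1) = 0 almost surely
   then sum_j Q_j exp(l r_j(x)) does not depend on x in I, first almost
   everywhere, then by continuity. Hence the square matrix (exp(l r_j(x_i))) is
   singular, and l is a zero of its determinant, an exponential sum in which the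
   term of the identity permutation has an exponent of its own; by Rolle there
   are finitely many such l.
   Moreover l determines D. Perturb the optimal channel, with density w relative
   to P x Q, to (1 - e) w + e for small e of either sign: this moves the
   distortion by an amount y proportional to e and gives
   (log_e 2) R(D + y) <= l D - Lambda(l) + l y + O(y^2), where
   l D - Lambda(l) = (log_e 2) R(D) since f_D vanishes. So the graph of R lies
   below a parabola of slope l / log_e 2 at D, and strict convexity allows at
   most one such D for each slope. *)

(** * Zeros of exponential sums and of determinants of exponentials *)

(** By Rolle a zero of [f'] lies strictly between two zeros of [f], so the number of zeros of [f']
    below a point is injective on the zeros of [f]; it takes finitely many values. *)
Lemma finite_zeros_of_derive (R : realType) (f f' : R -> R) :
  (forall x : R, is_derive x 1 f (f' x)) -> finite_set [set x | f' x = 0] ->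
  finite_set [set x | f x = 0].
Proof.
move=> df /finite_seqP[s s_eq].
pose below x := count (fun y => y < x) s.
have below_lt x y : f x = 0 -> f y = 0 -> x < y -> (below x < below y)%N.
  move=> fx fy xy.
  have [|||z] := @Rolle R f x y xy.
  - by move=> u _; have [] := df u.
  - by apply: derivable_within_continuous => u _; have [] := df u.
  - by rewrite fx fy.
  rewrite in_itv/= => /andP[xz zy] dz.
  have z_s : z \in s.
    have : [set x | f' x = 0] z.
      by rewrite /= -(@derive_val _ _ _ _ _ _ _ (df z)) (@derive_val _ _ _ _ _ _ _ dz).
    by rewrite s_eq.
  rewrite /below; elim: s z_s {s_eq below} => // t s ih.
  rewrite inE => /orP[/eqP <-|zs] /=.
    rewrite zy ltNge (ltW xz) /= add0n add1n ltnS.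
    by apply: sub_count => u /= ux; exact: lt_trans xy.
  have : ((t < x)%R <= (t < y)%R)%N.
    by case: (boolP (t < x)) => // tx; rewrite (lt_trans tx xy).
  by move=> le; rewrite -addnS leq_add ?ih.
rewrite -(eq_finite_set (inj_card_eq (f := below) _)).
  apply: sub_finite_set (finite_II (size s).+1) => _ [x _ <-] /=.
  by rewrite ltnS count_size.
move=> x y; rewrite !inE/= => fx fy bxy; apply/eqP; case: ltgtP => // xy.
  by have := below_lt _ _ fx fy xy; rewrite bxy ltnn.
by have := below_lt _ _ fy fx xy; rewrite bxy ltnn.
Qed.

(* Rolle after dividing by one of the other exponentials, which removes that
   term from the derivative. *)
Lemma finite_zeros_exp_sum (R : realType) (c b : R) (s : seq (R * R)) :
  c != 0 -> (forall p, p \in s -> p.2 != b) ->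
  finite_set [set l | c * expR (b * l) + \sum_(p <- s) p.1 * expR (p.2 * l) = 0].
Proof.
have [n] := ubnP (size s); elim: n s c b => // n ih [|q s] c b sn c0 sb.
  apply: (@sub_finite_set _ _ set0) => // l /=.
  rewrite big_nil addr0 => /eqP.
  by rewrite mulf_eq0 (negbTE c0) gt_eqF// expR_gt0.
pose F l := c * expR ((b - q.2) * l) + q.1
            + \sum_(p <- s) p.1 * expR ((p.2 - q.2) * l).
have -> : [set l | c * expR (b * l) + \sum_(p <- q :: s) p.1 * expR (p.2 * l) = 0]
    = [set l | F l = 0].
  have E l : c * expR (b * l) + \sum_(p <- q :: s) p.1 * expR (p.2 * l) =
             expR (q.2 * l) * F l.
    rewrite /F big_cons !mulrDr mulr_sumr addrA.
    have shift u v : expR (q.2 * l) * (v * expR ((u - q.2) * l)) = v * expR (u * l).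
      by rewrite mulrCA -expRD -mulrDl addrC subrK.
    rewrite shift [expR (q.2 * l) * q.1]mulrC; congr (_ + _ + _).
    by apply: eq_bigr => p _; rewrite shift.
  apply/seteqP; split=> l /=; rewrite E; last by move->; rewrite mulr0.
  by move/eqP; rewrite mulf_eq0 gt_eqF ?expR_gt0//= => /eqP.
have dexp (u v l : R) : is_derive l 1 (fun l => u * expR (v * l)) (u * v * expR (v * l)).
  have d1 : is_derive l 1 (fun l => v * l) v.
    have := is_deriveZ (v : R) (is_derive_id l (1 : R)).
    by rewrite [X in is_derive _ _ _ X -> _]mulr1; exact.
  apply: is_derive_eq (is_deriveZ (u : R) (is_derive1_comp (is_derive_expR (v * l)) d1)) _.
  by rewrite /GRing.scale/= mulrA mulrAC.
(* The derivative of [F] has one term fewer and is again of the given form: its leading coefficient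
   [c * (b - q.2)] is nonzero since [q.2 != b], and a common shift keeps the leading exponent apart
   from the others, which may repeat among themselves. *)
pose s' := [seq (p.1 * (p.2 - q.2), p.2 - q.2) | p <- s].
apply: (@finite_zeros_of_derive _ F (fun l => c * (b - q.2) * expR ((b - q.2) * l)
          + \sum_(p <- s') p.1 * expR (p.2 * l))) => [l|].
  rewrite /F /s' big_map /=.
  apply: is_deriveD.
    have := is_deriveD (dexp c (b - q.2) l) (is_derive_cst q.1 l (1 : R)).
    by rewrite addr0; exact.
  clear -dexp; elim: s => [|p s ih].
    rewrite big_nil.
    have -> : (fun l => \sum_(p <- [::]) p.1 * expR ((p.2 - q.2) * l)) = cst 0 :> (R -> R).
      by apply/funext => x; rewrite big_nil.
    exact: is_derive_cst.
  rewrite big_cons.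
  have -> : (fun l => \sum_(p <- p :: s) p.1 * expR ((p.2 - q.2) * l)) =
     (fun l => p.1 * expR ((p.2 - q.2) * l)) \+
     (fun l => \sum_(p <- s) p.1 * expR ((p.2 - q.2) * l)) :> (R -> R).
    by apply/funext => x; rewrite big_cons.
  exact: is_deriveD.
apply: ih; first by rewrite size_map.
  by rewrite mulf_neq0// subr_eq0 eq_sym sb// mem_head.
move=> p /mapP[t ts ->] /=.
by rewrite (inj_eq (addIr _)) sb// inE ts orbT.
Qed.

(** In the Leibniz expansion the permutation [s] contributes a signed exponential with exponent
    [\sum_j r j (s j)]. No other term shares the exponent of the identity, so its coefficient 1
    cannot cancel. *)
Lemma finite_zeros_exp_det (R : realType) (n : nat) (r : 'I_n -> 'I_n -> R) :
  (forall s : 'S_n, s != 1%g -> \sum_j r j j != \sum_j r j (s j)) ->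
  finite_set [set l | \det (\matrix_(j, i) expR (l * r j i)) = 0].
Proof.
move=> r_perm.
pose t := [seq ((-1) ^+ s, \sum_j r j (s j)) |
  s : 'S_n <- enum [pred s : 'S_n | s != 1%g]] : seq (R * R).
have := @finite_zeros_exp_sum R 1 (\sum_j r j j) t (oner_neq0 _) _.
have -> : [set l | \det (\matrix_(j, i) expR (l * r j i)) = 0] =
  [set l | 1 * expR ((\sum_j r j j) * l) + \sum_(p <- t) p.1 * expR (p.2 * l) = 0].
  apply: eq_set => l; congr (_ = _).
  rewrite /determinant (bigD1 1%g)//= odd_perm1 expr0; congr (_ * _ + _).
    rewrite mulrC mulr_sumr expR_sum; apply: eq_bigr => j _.
    by rewrite mxE perm1.
  rewrite /t big_map big_enum_cond/=; apply: eq_big => [s|s _]; first by rewrite andbT.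
  rewrite mulrC [X in expR X]mulrC mulr_sumr expR_sum mulrC; congr (_ * _).
  by apply: eq_bigr => j _; rewrite mxE.
apply=> p /mapP[s]; rewrite mem_enum inE => s1 -> /=.
by rewrite eq_sym r_perm.
Qed.

(** * Bounded measurable functions and their integrals *)

Lemma measurable_neq0 d (T : measurableType d) (R : realType)
    (f : T -> measurableTypeR R) :
  measurable_fun [set: T] f -> measurable [set x | f x != 0].
Proof.
move=> /(_ measurableT _ (measurableC (measurable_set1 (0 : R)))).
by rewrite setTI; congr measurable; apply/seteqP; split => x /= /eqP.
Qed.

(** A class closed under all the operations below and integrable for every probability measure, so
    that integrability conditions reduce to closure properties. *)
Definition bounded_measurable d (T : measurableType d) (R : realType)
    (f : T -> R) :=
  measurable_fun [set: T] f /\ exists C, forall x, `|f x| <= C.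

Section bounded_measurable.
Context d (T : measurableType d) (R : realType).
Implicit Types f g : T -> R.
Local Notation bm := (@bounded_measurable d T R).

Lemma bounded_measurable_cst (c : R) : bm (fun=> c).
Proof. by split; [exact: measurable_cst|exists `|c|]. Qed.

Lemma bounded_measurableD f g : bm f -> bm g -> bm (fun x => f x + g x).
Proof.
move=> [mf [C hC]] [mg [K hK]]; split; first exact: measurable_funD.
by exists (C + K) => x; rewrite (le_trans (ler_normD _ _))// lerD.
Qed.

Lemma bounded_measurableM f g : bm f -> bm g -> bm (fun x => f x * g x).
Proof.
move=> [mf [C hC]] [mg [K hK]]; split; first exact: measurable_funM.
by exists (C * K) => x; rewrite normrM ler_pM.
Qed.

Lemma bounded_measurableZ (c : R) f : bm f -> bm (fun x => c * f x).
Proof. by move=> bf; apply: bounded_measurableM => //; exact: bounded_measurable_cst. Qed.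

Lemma bounded_measurableB f g : bm f -> bm g -> bm (fun x => f x - g x).
Proof.
move=> bf bg; under eq_fun do rewrite -mulN1r.
exact/bounded_measurableD/bounded_measurableZ.
Qed.

Lemma bounded_measurable_sum (I : Type) (s : seq I) (F : I -> T -> R) :
  (forall i, bm (F i)) -> bm (fun x => \sum_(i <- s) F i x).
Proof.
move=> bF; elim: s => [|i s ih].
  by under eq_fun do rewrite big_nil; exact: bounded_measurable_cst.
by under eq_fun do rewrite big_cons; exact: bounded_measurableD.
Qed.

Lemma bounded_measurable_expR f : bm f -> bm (fun x => expR (f x)).
Proof.
move=> [mf [C hC]]; split; first exact: measurableT_comp.
by exists (expR C) => x; rewrite ger0_norm ?expR_ge0// ler_expR (le_trans (ler_norm _)).
Qed.

Lemma bounded_measurable_ln f (c : R) :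
  0 < c -> bm f -> (forall x, c <= f x) -> bm (fun x => ln (f x)).
Proof.
move=> c0 [mf [C hC]] cf; split; first exact: measurableT_comp.
exists (`|ln c| + `|ln C|) => x.
have fx0 : 0 < f x by rewrite (lt_le_trans c0).
have fC : f x <= C by rewrite (le_trans (ler_norm _)).
have l1 : ln c <= ln (f x) by rewrite ler_ln ?posrE.
have l2 : ln (f x) <= ln C by rewrite ler_ln ?posrE// (lt_le_trans fx0).
have := ler_norm (- ln c); have := ler_norm (ln C); rewrite normrN.
have := normr_ge0 (ln c); have := normr_ge0 (ln C).
rewrite ler_norml; lra.
Qed.

Lemma bounded_measurable_inv f (c : R) :
  0 < c -> bm f -> (forall x, c <= f x) -> bm (fun x => (f x)^-1).
Proof.
move=> c0 bf cf; have fx0 x : 0 < f x by rewrite (lt_le_trans c0).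
under eq_fun do rewrite -[(f _)^-1]lnK ?posrE ?invr_gt0// lnV ?posrE// -mulN1r.
by apply: bounded_measurable_expR; apply: bounded_measurableZ;
  exact: bounded_measurable_ln cf.
Qed.

Variable P : probability T R.

Lemma bounded_measurable_integrable f : bm f -> P.-integrable setT (EFin \o f).
Proof.
move=> [mf [C hC]]; apply: measurable_bounded_integrable => //.
  by rewrite (le_lt_trans (probability_le1 _ _)) ?ltry.
exists C; split; first exact: num_real.
by move=> x Cx y _; apply: (le_trans (hC y)); exact: ltW.
Qed.

Lemma bm_RintegralD f g : bm f -> bm g ->
  \int[P]_x (f x + g x) = \int[P]_x f x + \int[P]_x g x.
Proof. by move=> bf bg; rewrite RintegralD//; exact: bounded_measurable_integrable. Qed.

Lemma bm_RintegralB f g : bm f -> bm g ->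
  \int[P]_x (f x - g x) = \int[P]_x f x - \int[P]_x g x.
Proof. by move=> bf bg; rewrite RintegralB//; exact: bounded_measurable_integrable. Qed.

Lemma bm_RintegralZ (c : R) f : bm f ->
  \int[P]_x (c * f x) = c * \int[P]_x f x.
Proof. by move=> bf; rewrite RintegralZl//; exact: bounded_measurable_integrable. Qed.

Lemma bm_le_Rintegral f g : bm f -> bm g -> (forall x, f x <= g x) ->
  \int[P]_x f x <= \int[P]_x g x.
Proof. by move=> bf bg fg; apply: le_Rintegral => //; exact: bounded_measurable_integrable. Qed.

Lemma Rintegral_prob_cst (c : R) : \int[P]_x c = c.
Proof.
rewrite Rintegral_cst; last exact: measurableT.
by rewrite [fine _](congr1 fine (probability_setT P)) mulr1.
Qed.

Lemma bm_Rintegral_sum (I : Type) (s : seq I) (F : I -> T -> R) :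
  (forall i, bm (F i)) ->
  \int[P]_x (\sum_(i <- s) F i x) = \sum_(i <- s) \int[P]_x F i x.
Proof.
move=> bF; elim: s => [|i s ih].
  by under eq_Rintegral do rewrite big_nil; rewrite big_nil Rintegral_prob_cst.
under eq_Rintegral do rewrite big_cons.
by rewrite bm_RintegralD ?ih ?big_cons//; exact: bounded_measurable_sum.
Qed.

Lemma bm_integralE f : bm f -> (\int[P]_x (f x)%:E = (\int[P]_x f x)%:E)%E.
Proof.
move=> bf; rewrite /Rintegral fineK//; apply: integrable_fin_num => //.
exact: bounded_measurable_integrable.
Qed.

End bounded_measurable.

(** * Measures given by a density or by atoms *)

Lemma density_dominates d (T : measurableType d) (R : realType)
    (mu nu : {measure set T -> \bar R}) (h : T -> R) :
  measurable_fun [set: T] h ->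
  (forall A, measurable A -> nu A = (\int[mu]_(x in A) (h x)%:E)%E) ->
  nu `<< mu.
Proof.
move=> mh nuE; apply/null_content_dominatesP => A mA muA.
rewrite nuE// null_set_integral//.
exact/measurable_funTS/measurable_EFinP.
Qed.

(** An explicit density agrees [mu]-almost everywhere with the Radon-Nikodym derivative, hence
    [W]-almost everywhere by domination, and the entropy is an integral against [W]. *)
Lemma relative_entropy_density d (T : measurableType d) (R : realType)
    (mu : {sigma_finite_measure set T -> \bar R}) (W : probability T R) (h : T -> R) :
  measurable_fun [set: T] h ->
  (forall A, measurable A -> W A = (\int[mu]_(x in A) (h x)%:E)%E) ->
  relative_entropy W mu = (\int[W]_x (log2 (h x))%:E)%E.
Proof.
move=> mh WE; have dom := density_dominates mh WE.
rewrite /relative_entropy; case: pselect => // {}dom.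
have mlog (f : T -> R) : measurable_fun setT f ->
    measurable_fun setT (fun x => (log2 (f x))%:E).
  move=> mf; apply/measurable_EFinP; apply: measurable_funM => //.
  exact: measurableT_comp.
apply: ae_eq_integral => //; [|exact: mlog|].
  by apply: mlog; apply: measurableT_comp.
have : ae_eq W setT ('d (charge_of_finite_measure W) '/d mu) (EFin \o h).
  apply: (null_dominates_ae_eq measurableT dom); apply: integral_ae_eq => //.
  - exact: Radon_Nikodym_integrable.
  - exact/measurable_EFinP.
  by move=> E _ mE; rewrite -Radon_Nikodym_integral//= WE.
by apply: filterS => x /[apply] /= ->.
Qed.

Section density_measure.
Local Open Scope ereal_scope.
Context d (T : measurableType d) (R : realType)
  (mu : {sigma_finite_measure set T -> \bar R}).
Variable h : T -> R.
Hypotheses (mh : measurable_fun [set: T] h) (h0 : forall x, (0 <= h x)%R).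
Hypothesis h1 : \int[mu]_x (h x)%:E = 1.

Definition density_measure (A : set T) : \bar R := \int[mu]_(x in A) (h x)%:E.

Let density0 : density_measure set0 = 0.
Proof. exact: integral_set0. Qed.

Let density_ge0 A : 0 <= density_measure A.
Proof. by apply: integral_ge0 => x _; rewrite lee_fin. Qed.

Let density_sigma_additive : semi_sigma_additive density_measure.
Proof.
apply: (@semi_sigma_additive_nng_induced _ _ _ mu (EFin \o h)).
  exact/measurable_EFinP.
by move=> x; rewrite lee_fin.
Qed.

HB.instance Definition _ := isMeasure.Build _ _ _ density_measure
  density0 density_ge0 density_sigma_additive.

Let density_setT : density_measure [set: T] = 1.
Proof. exact: h1. Qed.

HB.instance Definition _ :=
  Measure_isProbability.Build _ _ _ density_measure density_setT.

Lemma density_probability : exists W : probability T R,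
  (forall A, W A = \int[mu]_(x in A) (h x)%:E) /\
  forall f : T -> \bar R, measurable_fun [set: T] f -> (forall x, 0 <= f x) ->
    \int[W]_x f x = \int[mu]_x (f x * (h x)%:E).
Proof.
pose W : probability T R := density_measure.
have WE A : W A = \int[mu]_(x in A) (h x)%:E by [].
exists W; split=> // f mf f0.
have dom := density_dominates mh (fun A _ => WE A).
(* The change of variables is first made with the Radon-Nikodym derivative, which is then exchanged
   for [h] almost everywhere. *)
rewrite -(Radon_Nikodym_SigmaFinite.change_of_variables dom)//.
have mRN := measurable_int _ (Radon_Nikodym_SigmaFinite.f_integrable dom).
apply: ae_eq_integral => //; [exact: emeasurable_funM| |].
  by apply: emeasurable_funM => //; exact/measurable_EFinP.
apply: ae_eqe_mul2l; apply: integral_ae_eq => //.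
- exact: Radon_Nikodym_SigmaFinite.f_integrable.
- exact/measurable_EFinP.
- by move=> E _ mE; rewrite -Radon_Nikodym_SigmaFinite.f_integral.
Qed.

End density_measure.

Section atomic_measure.
Local Open Scope ereal_scope.
Context d (T : measurableType d) (R : realType) (k : nat).
Variables (a : 'I_k -> T) (S : 'I_k -> R).
Hypothesis S_pmf : is_pmf S.

(** [msum] adds up a sequence indexed by the naturals, so the family over ['I_k] is continued by the
    zero measure. *)
Let atom (n : nat) : {measure set T -> \bar R} :=
  if insub n is Some j then mscale (NngNum (S_pmf.1 j)) (dirac (a j)) else mzero.

Definition atomic_measure : set T -> \bar R := msum atom k.

HB.instance Definition _ := Measure.on atomic_measure.

Let integral_atomic (f : T -> \bar R) :
  measurable_fun [set: T] f -> (forall x, 0 <= f x) ->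
  \int[atomic_measure]_x f x = \sum_j (S j)%:E * f (a j).
Proof.
move=> mf f0; rewrite ge0_integral_measure_sum//.
apply: eq_bigr => j _; rewrite /atom.
have -> : insub (val j) = Some j by rewrite valK.
by rewrite ge0_integral_mscale//= integral_dirac// diracT mul1e.
Qed.

Let atomic_setT : atomic_measure [set: T] = 1.
Proof.
transitivity (\sum_(j < k) atom j [set: T]); first by [].
transitivity (\sum_(j < k) (S j)%:E); last by rewrite sumEFin S_pmf.2.
by apply: eq_bigr => j _; rewrite /atom valK /= /mscale /= diracE in_setT mule1.
Qed.

HB.instance Definition _ :=
  Measure_isProbability.Build _ _ _ atomic_measure atomic_setT.

Lemma atomic_probability : exists W : probability T R,
  forall f : T -> \bar R, measurable_fun [set: T] f -> (forall x, 0 <= f x) ->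
  \int[W]_x f x = \sum_j (S j)%:E * f (a j).
Proof. by exists atomic_measure; exact: integral_atomic. Qed.

End atomic_measure.

(** * Joint law and mutual information of a channel with finite output alphabet *)

Section channel.
Context d1 d2 (T1 : measurableType d1) (T2 : measurableType d2) (R : realType).
Context (k : nat) (a : 'I_k -> T2) (P : probability T1 R).
Hypotheses (a_inj : injective a) (measurable_a : forall j, measurable [set a j]).
Variables (S : 'I_k -> R) (h : 'I_k -> T1 -> R) (c : R).
Hypotheses (S_pmf : is_pmf S) (c_gt0 : 0 < c).
Hypothesis bounded_h : forall j, bounded_measurable (h j).
Hypothesis h_ge : forall j x, c <= h j x.
Hypothesis integral_h : forall j, \int[P]_x h j x = 1.
Hypothesis sum_h : forall x, \sum_j S j * h j x = 1.

Let h_gt0 j x : 0 < h j x. Proof. exact: lt_le_trans (h_ge j x). Qed.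

Let Sh_ge0 j x : 0 <= S j * h j x.
Proof. by apply: mulr_ge0; [exact: S_pmf.1|exact: ltW]. Qed.

(* Density of the joint law with respect to the product of its marginals. *)
Let H (z : T1 * T2) : R := \sum_j h j z.1 * \1_[set a j] z.2.

Let H_ge0 z : 0 <= H z.
Proof. by apply: sumr_ge0 => j _; rewrite mulr_ge0// ltW. Qed.

Let H_atom x j : H (x, a j) = h j x.
Proof.
rewrite /H (bigD1 j)//= indicE mem_set// mulr1 big1 ?addr0// => i ij.
by rewrite indicE memNset ?mulr0//= => /a_inj ji; rewrite ji eqxx in ij.
Qed.

Let H_off x y : (forall j, y <> a j) -> H (x, y) = 0.
Proof.
move=> ya; rewrite /H big1// => j _.
by rewrite indicE memNset ?mulr0//; exact: ya.
Qed.

Let measurable_H : measurable_fun [set: T1 * T2] H.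
Proof.
apply: measurable_sum => j; apply: measurable_funM.
  by apply: measurableT_comp => //; have [] := bounded_h j.
exact: (measurableT_comp (f := \1_[set a j] : T2 -> R)).
Qed.

Let integral_joint (Sm : probability T2 R) :
  (forall f : T2 -> \bar R, measurable_fun [set: T2] f -> (forall x, 0 <= f x)%E ->
   \int[Sm]_x f x = \sum_j (S j)%:E * f (a j))%E ->
  forall F : T1 * T2 -> \bar R, measurable_fun [set: T1 * T2] F ->
  (forall z, 0 <= F z)%E ->
  (\int[P \x Sm]_z (F z * (H z)%:E) =
   \int[P]_x \sum_j (S j * h j x)%:E * F (x, a j))%E.
Proof.
move=> SmE F mF F0.
have mFH : measurable_fun [set: T1 * T2] (fun z => F z * (H z)%:E)%E.
  by apply: emeasurable_funM => //; exact/measurable_EFinP.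
have FH0 z : (0 <= F z * (H z)%:E)%E by rewrite mule_ge0 ?lee_fin.
rewrite fubini_tonelli1//; apply: eq_integral => x _; rewrite /fubini_F SmE//.
  apply: eq_bigr => j _; rewrite H_atom EFinM -muleA; congr (_ * _)%E.
  exact: muleC.
exact: (measurable_fun_pair2 x mFH).
Qed.

(** The input [x] is sent to [a j] with probability [S j * h j x]. Then [sum_h] makes [P] the first
    marginal and [integral_h] makes [S] the second, so [H] is the density relative to the product of
    the marginals and its logarithm integrates to the mutual information. *)
Lemma channel_probability : exists W : probability (T1 * T2)%type R,
  [/\ forall B, measurable B -> W (fst @^-1` B) = P B,
      forall F : T1 * T2 -> \bar R, measurable_fun [set: T1 * T2] F ->
        (forall z, 0 <= F z)%E ->
        (\int[W]_z F z = \int[P]_x \sum_j (S j * h j x)%:E * F (x, a j))%E &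
      mutual_information W =
        (\int[P]_x \sum_j S j * h j x * log2 (h j x))%:E].
Proof.
have [Sm SmE] := atomic_probability a S_pmf.
pose mu : {sigma_finite_measure set (T1 * T2)%type -> \bar R} :=
  product_subprobability (P : subprobability T1 R, Sm : subprobability T2 R).
have jointE := integral_joint SmE.
have muH : (\int[mu]_z (H z)%:E = 1)%E.
  have := jointE (cst 1%E) (measurable_cst _) (fun _ => lee01).
  under eq_integral do rewrite mul1e.
  rewrite -/mu => ->; under eq_integral => x _.
    under eq_bigr do rewrite mule1.
    rewrite sumEFin sum_h.
    over.
  by rewrite integral_cst// mul1e; exact: probability_setT.
have [W [WE WF]] := density_probability measurable_H H_ge0 muH.
have {}WF F (mF : measurable_fun setT F) (F0 : forall z, (0 <= F z)%E) :
  (\int[W]_z F z = \int[P]_x \sum_j (S j * h j x)%:E * F (x, a j))%E.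
  by rewrite WF// jointE.
have W_ind E : measurable E ->
    W E = (\int[P]_x \sum_j (S j * h j x)%:E * (\1_E (x, a j))%:E)%E.
  move=> mE; rewrite -(WF (fun z => (\1_E z)%:E)).
  - by rewrite integral_indic ?setIT.
  - exact/measurable_EFinP/measurable_indic.
  - by move=> z; rewrite lee_fin.
have W_fst B : measurable B -> W (fst @^-1` B) = P B.
  move=> mB; rewrite W_ind; last first.
    by rewrite -[X in measurable X]setTI; exact: measurable_fst.
  under eq_integral => x _.
    under eq_bigr => j _.
      have -> : \1_(fst @^-1` B) (x, a j) = \1_B x :> R by [].
      over.
    rewrite -ge0_sume_distrl; last by move=> j _; rewrite lee_fin.
    rewrite sumEFin sum_h mul1e.
    over.
  by rewrite integral_indic ?setIT.
have W_snd B : measurable B -> W (snd @^-1` B) = Sm B.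
  move=> mB; rewrite W_ind; last first.
    by rewrite -[X in measurable X]setTI; exact: measurable_snd.
  under eq_integral => x _.
    under eq_bigr => j _.
      have -> : \1_(snd @^-1` B) (x, a j) = \1_B (a j) :> R by [].
      rewrite -EFinM mulrAC.
      over.
    rewrite sumEFin.
    over.
  rewrite bm_integralE; last first.
    by apply: bounded_measurable_sum => j; exact: bounded_measurableZ.
  rewrite bm_Rintegral_sum; last by move=> j; exact: bounded_measurableZ.
  under eq_bigr do rewrite bm_RintegralZ// integral_h mulr1.
  rewrite -[in RHS](setIT B) -integral_indic// SmE ?sumEFin//.
  exact/measurable_EFinP/measurable_indic.
exists W; split=> //.
pose mu' : {sigma_finite_measure set (T1 * T2)%type -> \bar R} :=
  product_subprobability
       (distribution W (@fst T1 T2) : subprobability T1 R,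
        distribution W (@snd T1 T2) : subprobability T2 R).
(* [mutual_information] refers to the product of the marginals of [W]; agreement on rectangles
   identifies it with the product used to build [W]. *)
have mu_mu' A : measurable A -> mu A = mu' A.
  move=> mA; apply: product_measure_unique => // X Y mX mY.
  by rewrite [LHS]product_measure1E//; congr (_ * _)%E; [exact: W_fst|exact: W_snd].
rewrite /mutual_information (@relative_entropy_density _ _ _ _ _ H)//; last first.
  move=> A mA; rewrite WE; apply: eq_measure_integral => B mB _.
  exact: mu_mu'.
pose L z := log2 (H z).
have mL : measurable_fun [set: T1 * T2] L.
  by apply: measurable_funM => //; exact: measurableT_comp.
have /choice[C C_h] : forall j, exists C, forall x, `|log2 (h j x)| <= C.
  move=> j.
  have [_ [C hC]] : bounded_measurable (fun x => log2 (h j x)).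
    apply: bounded_measurableM; last exact: bounded_measurable_cst.
    exact: bounded_measurable_ln (h_ge j).
  by exists C.
have C_ge0 j : 0 <= C j by exact: le_trans (C_h j point).
pose K := \sum_j C j.
have K_ge z : `|L z| <= K.
  case: z => x y; rewrite /L.
  have [[j ->]|ya] := pselect (exists j, y = a j).
    rewrite H_atom (le_trans (C_h j x))// /K (bigD1 j)//= lerDl.
    exact: sumr_ge0.
  (* Off the atoms the density is 0, where [ln] has the default value 0, so [L] is bounded
     everywhere. *)
  rewrite H_off; last by move=> j yj; apply: ya; exists j.
  by rewrite /log2 ln0// mul0r normr0 sumr_ge0.
have bL : bounded_measurable L by split=> //; exists K.
have bLh : bounded_measurable (fun x => \sum_j S j * h j x * log2 (h j x)).
  apply: bounded_measurable_sum => j; apply: bounded_measurableM.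
    exact: bounded_measurableZ.
  apply: bounded_measurableM; last exact: bounded_measurable_cst.
  exact: bounded_measurable_ln (h_ge j).
rewrite bm_integralE//; congr _%:E.
(* [WF] is restricted to nonnegative integrands while [L] may take both signs: shift by the bound
   [K], integrate, and shift back. *)
have -> : \int[W]_z L z = \int[W]_z (L z + K) - K.
  by rewrite bm_RintegralD ?Rintegral_prob_cst ?addrK//; exact: bounded_measurable_cst.
apply/eqP; rewrite subr_eq; apply/eqP.
rewrite -[X in _ + X](@Rintegral_prob_cst _ _ _ P) -bm_RintegralD//; last first.
  exact: bounded_measurable_cst.
rewrite /Rintegral; congr fine; rewrite WF.
- apply: eq_integral => x _.
  under eq_bigr do rewrite /L H_atom -EFinM mulrDr.
  by rewrite sumEFin big_split/= -mulr_suml sum_h mul1r.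
- apply/measurable_EFinP; exact: measurable_funD.
- by move=> z; rewrite lee_fin -lerBlDr sub0r; have := K_ge z; rewrite ler_norml => /andP[].
Qed.

End channel.

(** * Upper bounds on the rate-distortion function from channels *)

Lemma subr1_le_xlnx (R : realType) (x : R) : 0 < x -> x - 1 <= x * ln x.
Proof.
move=> x0; have := expR_ge1Dx (- ln x).
rewrite expRN lnK ?posrE// -(ler_pM2l x0) mulfV ?gt_eqF// => h.
lra.
Qed.

(** The sum is the relative entropy of the law [Q j * w j] with respect to [Q]; the termwise bound
    [x - 1 <= x * ln x] averages to 0. *)
Lemma sum_xlnx_ge0 (R : realType) (k : nat) (Q w : 'I_k -> R) :
  is_pmf Q -> (forall j, 0 < w j) -> \sum_j Q j * w j = 1 ->
  0 <= \sum_j Q j * w j * log2 (w j).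
Proof.
move=> [Q0 Q1] w0 Qw.
under eq_bigr do rewrite /log2 mulrA.
rewrite -mulr_suml mulr_ge0 ?invr_ge0 ?ln_ge0 ?ler1n//.
apply: (@le_trans _ _ (\sum_j (Q j * w j - Q j))).
  by rewrite sumrB Qw Q1 subrr.
apply: ler_sum => j _; rewrite -mulrA -[X in _ - X]mulr1 -mulrBr ler_wpM2l//.
exact: subr1_le_xlnx.
Qed.

Section default_structure.
Context (R : realType).
Local Notation RR := (measurableTypeR R).

(* [R] and [RR] carry the same measurable sets under different displays;
   the integral in [admissible] is taken over [RR * R]. *)
Let to_default (z : RR * RR) : (RR * R)%type := z.

Let measurable_to_default : measurable_fun [set: RR * RR] to_default.
Proof.
apply/measurable_fun_pairP; split; first exact: measurable_fst.
have m : measurable_fun [set: RR] (id : RR -> R).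
  by move=> _ Y mY; rewrite setTI; exact: mY.
by apply: (measurableT_comp m); exact: measurable_snd.
Qed.

Let measurable_of_default : measurable_fun [set: (RR * R)%type]
  (fun z => z : (RR * RR)%type).
Proof.
apply/measurable_fun_pairP; split; first exact: measurable_fst.
have m : measurable_fun [set: R] (id : R -> RR).
  by move=> _ Y mY; rewrite setTI; exact: mY.
by apply: (measurableT_comp m); exact: measurable_snd.
Qed.

Lemma integral_default (W : probability (RR * RR)%type R)
    (E : set (RR * RR)) (F : RR * R -> R) (G : RR * RR -> R) :
  measurable E -> measurable_fun [set: RR * RR] G -> (forall z, 0 <= G z) ->
  (forall z, E z -> F z = G z) ->
  (@integral _ (RR * R)%type R W E (fun z => (F z)%:E) =
   \int[W]_(z in E) (G z)%:E)%E.
Proof.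
move=> mE mG G0 FG.
have mE' : measurable (E : set (RR * R)%type).
  by have := measurable_of_default measurableT mE; rewrite setTI.
have mG' : measurable_fun [set: (RR * R)%type] G.
  exact: (measurableT_comp mG measurable_of_default).
have e : {in (E : set (RR * R)%type), (fun z => (F z)%:E) =1 (fun z => (G z)%:E)}.
  by move=> z; rewrite inE => /FG ->.
apply: etrans (@eq_integral _ _ R (pushforward W to_default) E _ _ e) _.
have := @ge0_integral_pushforward _ _ _ _ _ _ measurable_to_default W E
  (fun z => (G z)%:E) mE'.
apply.
  exact/measurable_funTS/measurable_EFinP.
by move=> z _; rewrite lee_fin.
Qed.

End default_structure.

Section rate_distortion_upper_bound.
Context (R : realType) (k : nat).
Local Notation RR := (measurableTypeR R).
Variables (a : 'I_k -> R) (M : R) (rho : R -> R -> R) (P : probability RR R).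
Hypothesis a_inj : injective a.
Hypothesis rho_bounded : forall x j, 0 <= rho x (a j) <= M.
Hypothesis rho_measurable : forall j,
  measurable_fun [set: RR] (fun x : RR => (rho x (a j) : RR)).

Lemma bounded_measurable_rho j : bounded_measurable (fun x : RR => rho x (a j)).
Proof.
split; first exact: rho_measurable.
by exists M => x; have /andP[r0 rM] := rho_bounded x j; rewrite ger0_norm.
Qed.

Lemma RD_le (D c : R) (Q : 'I_k -> R) (w : 'I_k -> RR -> R) :
  is_pmf Q -> 0 < c -> (forall j, bounded_measurable (w j)) ->
  (forall j x, c <= w j x) -> (forall x, \sum_j Q j * w j x = 1) ->
  \int[P]_x (\sum_j Q j * w j x * rho x (a j)) <= D ->
  RD P a rho D <= \int[P]_x (\sum_j Q j * w j x * log2 (w j x)).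
Proof.
move=> Q_pmf c0 bw cw Qw Dw.
have w0 j x : 0 < w j x by exact: lt_le_trans (cw j x).
have bQw j : bounded_measurable (fun x => Q j * w j x) by exact: bounded_measurableZ.
have blog j : bounded_measurable (fun x => log2 (w j x)).
  apply: bounded_measurableM; last exact: bounded_measurable_cst.
  exact: bounded_measurable_ln (cw j).
(* The output law is [Q j * m j], not [Q]; replacing it by [Q] costs its
   relative entropy, which is nonnegative. *)
pose m j := \int[P]_x w j x.
have cm j : c <= m j.
  rewrite -[leLHS](@Rintegral_prob_cst _ _ _ P); apply: bm_le_Rintegral => //.
  exact: bounded_measurable_cst.
have m0 j : 0 < m j by exact: lt_le_trans (cm j).
have Qm : \sum_j Q j * m j = 1.
  rewrite -[RHS](@Rintegral_prob_cst _ _ _ P).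
  under [RHS]eq_Rintegral => x _ do rewrite -(Qw x).
  by rewrite bm_Rintegral_sum//; apply: eq_bigr => j _; rewrite bm_RintegralZ.
have S_pmf : is_pmf (fun j => Q j * m j).
  by split=> // j; rewrite mulr_ge0 ?Q_pmf.1 ?ltW.
pose h j x := (m j)^-1 * w j x.
have Sh j x : Q j * m j * h j x = Q j * w j x by rewrite /h mulrA mulfK ?gt_eqF.
(* [K] dominates every [m j], which gives the normalized densities [h j] the common positive lower
   bound [K^-1 * c]. *)
pose K := 1 + \sum_j m j.
have mK j : m j <= K.
  by rewrite /K (bigD1 j)//= addrCA lerDl addr_ge0//; apply: sumr_ge0 => i _; exact: ltW.
have K0 : 0 < K by rewrite /K ltr_wpDr//; apply: sumr_ge0 => i _; exact: ltW.
have bh j : bounded_measurable (h j) by exact: bounded_measurableZ.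
have hK j x : K^-1 * c <= h j x.
  rewrite /h; apply: ler_pM => //; [|exact: ltW|by rewrite lef_pV2 ?posrE].
  by rewrite invr_ge0; exact: ltW.
have ih j : \int[P]_x h j x = 1 by rewrite /h bm_RintegralZ// mulVf ?gt_eqF.
have sh x : \sum_j Q j * m j * h j x = 1.
  by rewrite -(Qw x); apply: eq_bigr => j _; rewrite Sh.
have Kc0 : 0 < K^-1 * c by rewrite mulr_gt0 ?invr_gt0.
have m1 j : measurable ([set (a j : RR)] : set RR) by exact: measurable_set1.
have [W [W1 W2 W3]] := @channel_probability _ _ RR RR R k a P a_inj m1 _ h _
  S_pmf Kc0 bh hK ih sh.
have mrange : measurable ([set z : RR * RR | range a z.2]).
  have -> : [set z : RR * RR | range a z.2] =
      \bigcup_(j in [set: 'I_k]) (snd @^-1` [set (a j : RR)]).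
    by apply/seteqP; split=> z [j _ e]; exists j => //; exact: esym.
  apply: fin_bigcup_measurable; first exact: finite_finset.
  by move=> j _; have := @measurable_snd _ _ RR RR measurableT _ (m1 j); rewrite setTI.
have adm : admissible P a rho D W.
  split=> //.
    rewrite -[LHS]/(W _) -[in LHS](setIT [set z : RR * RR | _]) -integral_indic//.
    rewrite W2; [|exact/measurable_EFinP/measurable_indic|by move=> z; rewrite lee_fin].
    under eq_integral => x _.
      under eq_bigr => j _.
        rewrite indicE mem_set ?mule1; last by exists j.
        over.
      rewrite sumEFin sh.
      over.
    by rewrite integral_cst// mul1e; exact: probability_setT.
  (* Nothing is assumed about [rho] off [range a]; [G] coincides with it there and is measurable and
     nonnegative on the whole plane. *)
  pose G (z : RR * RR) : R := \sum_j rho z.1 (a j) * \1_[set (a j : RR)] z.2.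
  have Ga x j : G (x, a j) = rho x (a j).
    rewrite /G (bigD1 j)//= indicE mem_set// mulr1 big1 ?addr0// => i ij.
    by rewrite indicE memNset ?mulr0//= => /a_inj ji; rewrite ji eqxx in ij.
  have G0 z : 0 <= G z.
    by apply: sumr_ge0 => j _; rewrite mulr_ge0//; have /andP[] := rho_bounded z.1 j.
  have mG : measurable_fun [set: RR * RR] G.
    apply: measurable_sum => j; apply: measurable_funM.
      exact: (measurableT_comp (rho_measurable j)).
    exact: (measurableT_comp (f := \1_[set (a j : RR)] : RR -> R)).
  pose E := [set z : RR * RR | range a z.2].
  rewrite [leLHS](@integral_default _ W E _ G)//; last first.
    by move=> -[x y] [j _ /= <-]; rewrite Ga.
  apply: (@le_trans _ _ (\int[W]_z (G z)%:E)%E).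
    apply: ge0_subset_integral => //; first exact/measurable_EFinP.
    by move=> z _; rewrite lee_fin.
  rewrite W2; [|exact/measurable_EFinP|by move=> z; rewrite lee_fin].
  under eq_integral => x _.
    under eq_bigr do rewrite Ga -EFinM Sh.
    rewrite sumEFin.
    over.
  rewrite bm_integralE ?lee_fin//.
  apply: bounded_measurable_sum => j; apply: bounded_measurableM => //.
  exact: bounded_measurable_rho.
have bwl : bounded_measurable (fun x => \sum_j Q j * w j x * log2 (w j x)).
  by apply: bounded_measurable_sum => j; exact: bounded_measurableM.
set b := Rintegral _ _ _.
have b0 : 0 <= b.
  rewrite -[leLHS](@Rintegral_prob_cst _ _ _ P); apply: bm_le_Rintegral => //.
    exact: bounded_measurable_cst.
  by move=> x; exact: sum_xlnx_ge0.
have vE : \int[P]_x (\sum_j Q j * m j * h j x * log2 (h j x)) =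
    b - \sum_j Q j * m j * log2 (m j).
  transitivity (\int[P]_x (\sum_j Q j * w j x * log2 (w j x) -
                           \sum_j Q j * log2 (m j) * w j x)).
    apply: eq_Rintegral => x _; rewrite -sumrB; apply: eq_bigr => j _.
    rewrite Sh /h /log2 lnM ?posrE ?invr_gt0// lnV ?posrE//; ring.
  have bQlw j : bounded_measurable (fun x => Q j * log2 (m j) * w j x).
    exact: bounded_measurableZ.
  rewrite bm_RintegralB//; last exact: bounded_measurable_sum.
  congr (_ - _); rewrite bm_Rintegral_sum//; apply: eq_bigr => j _.
  by rewrite bm_RintegralZ// mulrAC.
have vb : (rate_distortion P a rho D <= b%:E)%E.
  apply: (@le_trans _ _ (mutual_information W)).
    by apply: ereal_inf_lbound; exists W.
  by rewrite W3 lee_fin vE lerBlDr lerDl; exact: sum_xlnx_ge0.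
(* For the value [-oo] the function [fine] returns 0, and the claim is [b0]. *)
by rewrite /RD; move: vb; case: (rate_distortion _ _ _ _).
Qed.

End rate_distortion_upper_bound.

(** * The tilted channel and its perturbations *)

(** The first two summands on the right form the tangent line of [y * ln y] at [x]; the last bounds
    the error, by [1 + ln (y / x) <= y / x]. *)
Lemma xlnx_le (R : realType) (x y : R) : 0 < x -> 0 < y ->
  y * ln y <= y * ln x + (y - x) + (y - x) ^+ 2 / x.
Proof.
move=> x0 y0; have y0' := lt0r_neq0 y0; have x0' := lt0r_neq0 x0.
have := expR_ge1Dx (ln y - ln x).
rewrite expRD expRN !lnK ?posrE// => h.
have : y * (1 + (ln y - ln x)) <= y * (y / x) by rewrite ler_wpM2l// ltW.
have -> : y * (y / x) = y + (y - x) + (y - x) ^+ 2 / x by field.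
by rewrite mulrDr mulr1 mulrBr => ?; lra.
Qed.

(** Difference quotients are at least [T] on the right and at most [T] on the left. This identifies
    the derivative of [Lambda] without differentiating under the integral. *)
Lemma derive_subgradient (R : realType) (f : R -> R) (x D T r : R) :
  is_derive x 1 f D -> 0 < r ->
  (forall h, `|h| < r -> h * T <= f (x + h) - f x) -> D = T.
Proof.
move=> [df Df] r0 fT.
have cv : (fun h => h^-1 *: (f (h *: 1 + x) - f x)) @ 0^' --> D.
  by rewrite -Df; exact: df.
have near_D e : 0 < e -> exists2 d, 0 < d & forall h, `|h| < d -> h != 0 ->
    `|D - h^-1 *: (f (h *: 1 + x) - f x)| < e.
  move=> e0; move/cvgrPdist_lt : cv => /(_ _ e0).
  move=> -[d /= d0 hd]; exists d => // h hd' h0.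
  by apply: hd => //=; rewrite sub0r normrN.
apply/eqP/negPn/negP => DT.
have e0 : 0 < `|D - T| by rewrite normr_gt0 subr_eq0.
have [d d0 hd] := near_D _ e0.
pose h := Num.min d r / 2.
have m0 : 0 < Num.min d r by rewrite lt_min d0.
have h0 : 0 < h by rewrite divr_gt0.
have hm : h < Num.min d r by rewrite /h; lra.
have hd' : h < d by rewrite (lt_le_trans hm)// ge_min lexx.
have hr' : h < r by rewrite (lt_le_trans hm)// ge_min lexx orbT.
have := hd h; have := hd (- h); rewrite normrN gtr0_norm// oppr_eq0 gt_eqF//.
move=> /(_ hd' isT) + /(_ hd' isT).
have := fT h; have := fT (- h); rewrite normrN gtr0_norm// => /(_ hr') + /(_ hr').
rewrite /GRing.scale/= !mulr1 [- h + x]addrC [h + x]addrC.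
rewrite invrN !mulNr.
set u := f (x - h) - f x; set v := f (x + h) - f x => hu hv.
have {}hv : T <= h^-1 * v by rewrite ler_pdivlMl.
have {}hu : - (h^-1 * u) <= T by rewrite lerNl ler_pdivlMl// mulrN.
rewrite opprK !ltr_norml => /andP[a1 a2] /andP[b1 b2].
move: a1 a2 b1 b2 hu hv; move: (h^-1 * u) (h^-1 * v) => u' v'.
by case: (ger0P (D - T)) => s *; lra.
Qed.

Section tilted_channel.
Context (R : realType) (k : nat).
Local Notation RR := (measurableTypeR R).
Variables (a : 'I_k -> R) (M : R) (rho : R -> R -> R) (P : probability RR R).
Hypothesis a_inj : injective a.
Hypothesis rho_bounded : forall x j, 0 <= rho x (a j) <= M.
Hypothesis rho_measurable : forall j,
  measurable_fun [set: RR] (fun x : RR => (rho x (a j) : RR)).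
Variable Q : 'I_k -> R.
Hypothesis Q_pmf : is_pmf Q.

Let bounded_rho j : bounded_measurable (fun x : RR => rho x (a j)).
Proof. exact: bounded_measurable_rho rho_bounded rho_measurable j. Qed.

Let bounded_exp l j : bounded_measurable (fun x : RR => expR (l * rho x (a j))).
Proof. exact/bounded_measurable_expR/bounded_measurableZ. Qed.

Let exp_ge l j x : l <= 0 -> expR (l * M) <= expR (l * rho x (a j)).
Proof.
by move=> l0; rewrite ler_expR ler_wnM2l//; have /andP[] := rho_bounded x j.
Qed.

Let exp_le l j x : l <= 0 -> expR (l * rho x (a j)) <= 1.
Proof.
move=> l0; rewrite -expR0 ler_expR mulr_le0_ge0//.
by have /andP[] := rho_bounded x j.
Qed.

Lemma bounded_measurable_mgf l :
  bounded_measurable (mgf a rho Q l : RR -> R).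
Proof. by apply: bounded_measurable_sum => j; exact: bounded_measurableZ. Qed.

Lemma mgf_ge l x : l <= 0 -> expR (l * M) <= mgf a rho Q l x.
Proof.
move=> l0; rewrite -[leLHS]mul1r -Q_pmf.2 mulr_suml; apply: ler_sum => j _.
by rewrite ler_wpM2l ?exp_ge//; exact: Q_pmf.1.
Qed.

Lemma mgf_gt0 l x : l <= 0 -> 0 < mgf a rho Q l x.
Proof. by move=> l0; exact: lt_le_trans (expR_gt0 _) (mgf_ge x l0). Qed.

Lemma mgf_le1 l x : l <= 0 -> mgf a rho Q l x <= 1.
Proof.
move=> l0; rewrite -Q_pmf.2; apply: ler_sum => j _.
by rewrite ler_piMr ?exp_le//; exact: Q_pmf.1.
Qed.

Lemma bounded_measurable_ln_mgf l : l <= 0 ->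
  bounded_measurable (fun x : RR => ln (mgf a rho Q l x)).
Proof.
move=> l0; apply: (@bounded_measurable_ln _ _ _ _ (expR (l * M))).
- exact: expR_gt0.
- exact: bounded_measurable_mgf.
- by move=> x; exact: mgf_ge.
Qed.

(** The Gibbs channel of parameter [lam], as a density relative to the product of [P] and [Q]. *)
Definition tilt (lam : R) (j : 'I_k) (x : RR) : R :=
  expR (lam * rho x (a j)) / mgf a rho Q lam x.

Variable lam : R.
Hypothesis lam_le0 : lam <= 0.
Let c := expR (lam * M).
Let c_gt0 : 0 < c. Proof. exact: expR_gt0. Qed.

Let bounded_tilt j : bounded_measurable (tilt lam j).
Proof.
apply: bounded_measurableM => //; apply: (@bounded_measurable_inv _ _ _ _ c) => //.
  exact: bounded_measurable_mgf.
by move=> x; exact: mgf_ge.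
Qed.

Let tilt_ge j x : c <= tilt lam j x.
Proof.
rewrite /tilt ler_pdivlMr ?mgf_gt0//.
by apply: le_trans (exp_ge j x lam_le0); rewrite ler_piMr ?expR_ge0// mgf_le1.
Qed.

Let tilt_gt0 j x : 0 < tilt lam j x. Proof. exact: lt_le_trans (tilt_ge j x). Qed.

Let tilt_le j x : tilt lam j x <= c^-1.
Proof.
rewrite /tilt -[leRHS]mul1r; apply: ler_pM; rewrite ?expR_ge0 ?exp_le//.
  by rewrite invr_ge0 ltW ?mgf_gt0.
by rewrite lef_pV2 ?posrE ?mgf_gt0// mgf_ge.
Qed.

Lemma sum_tilt x : \sum_j Q j * tilt lam j x = 1.
Proof.
under eq_bigr do rewrite mulrA.
by rewrite -mulr_suml divff// gt_eqF// mgf_gt0.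
Qed.

(** Jensen for the exponential under the tilted law at [x], whose mean distortion is the slope of
    the log-moment function at [lam]. *)
Lemma ln_mgf_subgradient l x : l <= 0 ->
  (l - lam) * (\sum_j Q j * tilt lam j x * rho x (a j)) <=
  ln (mgf a rho Q l x) - ln (mgf a rho Q lam x).
Proof.
move=> l0; set t := \sum_j _; set u := l - lam.
rewrite -ln_div ?posrE ?mgf_gt0//.
rewrite -[leLHS]expRK ler_ln ?posrE ?expR_gt0 ?divr_gt0 ?mgf_gt0//.
have -> : mgf a rho Q l x / mgf a rho Q lam x =
    \sum_j Q j * tilt lam j x * expR (u * rho x (a j)).
  rewrite /mgf mulr_suml; apply: eq_bigr => j _.
  rewrite /tilt (_ : l * rho x (a j) = lam * rho x (a j) + u * rho x (a j)).
    by rewrite expRD; ring.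
  by rewrite /u; ring.
(* The factors on the right are the values at [u * rho x (a j)] of the tangent to [expR] at [u * t];
   the linear parts cancel because [t] is the mean. *)
have -> : expR (u * t) = \sum_j Q j * tilt lam j x *
    (expR (u * t) * (1 + (u * rho x (a j) - u * t))).
  transitivity (expR (u * t) * ((1 - u * t) * (\sum_j Q j * tilt lam j x) + u * t)).
    by rewrite sum_tilt mulr1 subrK mulr1.
  rewrite /t !mulr_sumr -big_split/= mulr_sumr; apply: eq_bigr => j _; ring.
apply: ler_sum => j _; rewrite ler_wpM2l//.
  by apply: mulr_ge0; [exact: Q_pmf.1|exact: ltW].
have -> : u * rho x (a j) = u * t + (u * rho x (a j) - u * t) by rewrite addrC subrK.
by rewrite [leRHS]expRD ler_wpM2l ?expR_ge0// addrAC subrr add0r expR_ge1Dx.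
Qed.

Let bounded_tilt_rho :
  bounded_measurable (fun x => \sum_j Q j * tilt lam j x * rho x (a j)).
Proof.
apply: bounded_measurable_sum => j; apply: bounded_measurableM => //.
exact: bounded_measurableZ.
Qed.

(** Integrating the pointwise inequality makes the mean distortion a subgradient of [Lambda] at
    [lam]. Increments smaller than [- lam] keep the parameter nonpositive. *)
Lemma tilt_distortion D : lam < 0 -> is_derive lam 1 (Lambda P a rho Q) D ->
  \int[P]_x (\sum_j Q j * tilt lam j x * rho x (a j)) = D.
Proof.
move=> lam0 dL; set T := Rintegral _ _ _.
have sub l : l <= 0 -> (l - lam) * T <= Lambda P a rho Q l - Lambda P a rho Q lam.
  move=> l0; rewrite /T -bm_RintegralZ// /Lambda -bm_RintegralB; last 2 first.
  - exact: bounded_measurable_ln_mgf.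
  - exact: bounded_measurable_ln_mgf.
  apply: bm_le_Rintegral.
  - exact: bounded_measurableZ.
  - by apply: bounded_measurableB; exact: bounded_measurable_ln_mgf.
  - by move=> x; exact: ln_mgf_subgradient.
have lam0' : 0 < - lam by rewrite oppr_gt0.
apply/esym/(derive_subgradient dL lam0') => h; rewrite ltr_norml opprK => /andP[_ hlam].
have := sub (lam + h); rewrite addrAC subrr add0r; apply.
by rewrite -lerBrDl sub0r ltW.
Qed.

(* Moving the tilted channel towards or away from the product channel changes
   the distortion linearly, and the entropy linearly up to a quadratic error. *)
Lemma RD_variation D : lam < 0 -> is_derive lam 1 (Lambda P a rho Q) D ->
  exists2 C, 0 < C & exists2 e0, 0 < e0 & forall e, `|e| <= e0 ->
    let dD := e * (\int[P]_x (\sum_j Q j * rho x (a j)) - D) in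
    ln 2 * RD P a rho (D + dD) <=
      lam * D - Lambda P a rho Q lam + lam * dD + C * e ^+ 2.
Proof.
move=> lam0 dL; pose T0 := \int[P]_x (\sum_j Q j * rho x (a j)).
have TD := tilt_distortion lam0 dL.
have c_le1 : c <= 1 := le_trans (mgf_ge point lam_le0) (mgf_le1 point lam_le0).
have ci0 : 0 < c^-1 by rewrite invr_gt0.
have ci1 : 1 <= c^-1 by rewrite -[leLHS]invr1 lef_pV2 ?posrE.
(* Two factors [c^-1] bound the square of [1 - tilt], the third bounds the inverse of [tilt] in the
   error term of [xlnx_le]. *)
exists (c^-1 ^+ 3); first by rewrite exprn_gt0.
(* With this radius the perturbation is at most [c / 2], so the new density stays above [c / 2]. *)
exists (c ^+ 2 / 2); first by rewrite divr_gt0// exprn_gt0.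
move=> e he /=; rewrite -/T0; set dD := e * _.
pose v j (x : RR) := (1 - e) * tilt lam j x + e.
have bv j : bounded_measurable (v j).
  by apply: bounded_measurableD; [exact: bounded_measurableZ|exact: bounded_measurable_cst].
have w1 j x : `|1 - tilt lam j x| <= c^-1.
  rewrite ler_norml; have := tilt_le j x; have := tilt_gt0 j x.
  by move: (tilt lam j x) => w ? ?; apply/andP; split; lra.
have vE j x : v j x = tilt lam j x + e * (1 - tilt lam j x) by rewrite /v; ring.
have v_ge j x : c / 2 <= v j x.
  have : `|e * (1 - tilt lam j x)| <= c / 2.
    rewrite normrM (le_trans (ler_pM _ _ he (w1 j x)))//.
    by rewrite (_ : c ^+ 2 / 2 / c = c / 2)//; field; rewrite gt_eqF.
  rewrite ler_norml vE => /andP[h _]; have := tilt_ge j x.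
  by move: h; move: (e * _) => p; move: (tilt _ _ _) => q; lra.
have c2 : 0 < c / 2 by rewrite divr_gt0.
have v_gt0 j x : 0 < v j x by exact: lt_le_trans (v_ge j x).
have Qv x : \sum_j Q j * v j x = 1.
  transitivity ((1 - e) * (\sum_j Q j * tilt lam j x) + e * (\sum_j Q j)).
    rewrite !mulr_sumr -big_split/=; apply: eq_bigr => j _; rewrite /v; ring.
  by rewrite sum_tilt Q_pmf.2; ring.
have bQr : bounded_measurable (fun x : RR => \sum_j Q j * rho x (a j)).
  by apply: bounded_measurable_sum => j; exact: bounded_measurableZ.
have bQvr : bounded_measurable (fun x : RR => \sum_j Q j * v j x * rho x (a j)).
  apply: bounded_measurable_sum => j; apply: bounded_measurableM => //.
  exact: bounded_measurableZ.
have vD : \int[P]_x (\sum_j Q j * v j x * rho x (a j)) = D + dD.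
  transitivity (\int[P]_x ((1 - e) * (\sum_j Q j * tilt lam j x * rho x (a j)) +
                           e * (\sum_j Q j * rho x (a j)))).
    apply: eq_Rintegral => x _; rewrite !mulr_sumr -big_split/=.
    by apply: eq_bigr => j _; rewrite /v; ring.
  rewrite bm_RintegralD; [|exact: bounded_measurableZ..].
  by rewrite !bm_RintegralZ// TD -/T0 /dD; ring.
have ln20 : 0 < ln 2 :> R by rewrite ln_gt0// ltr1n.
have vD' : \int[P]_x (\sum_j Q j * v j x * rho x (a j)) <= D + dD by rewrite vD.
have hRD := RD_le a_inj rho_bounded rho_measurable Q_pmf c2 bv v_ge Qv vD'.
rewrite -(ler_pM2l ln20) in hRD; apply: le_trans hRD _.
have blog j : bounded_measurable (fun x : RR => log2 (v j x)).
  apply: bounded_measurableM; last exact: bounded_measurable_cst.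
  exact: bounded_measurable_ln (v_ge j).
have bQlog : bounded_measurable (fun x : RR => \sum_j Q j * v j x * log2 (v j x)).
  apply: bounded_measurable_sum => j; apply: bounded_measurableM => //.
  exact: bounded_measurableZ.
have blm := bounded_measurable_ln_mgf lam_le0.
pose F (x : RR) := lam * (\sum_j Q j * v j x * rho x (a j)) - ln (mgf a rho Q lam x)
            + c^-1 ^+ 3 * e ^+ 2.
rewrite -bm_RintegralZ//.
apply: (@le_trans _ _ (\int[P]_x F x)); last first.
  rewrite bm_RintegralD; [|by apply: bounded_measurableB => //; exact: bounded_measurableZ
    |exact: bounded_measurable_cst].
  rewrite bm_RintegralB//; last exact: bounded_measurableZ.
  rewrite bm_RintegralZ//. rewrite vD Rintegral_prob_cst -/(Lambda P a rho Q lam).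
  by rewrite le_eqVlt; apply/orP; left; apply/eqP; ring.
apply: bm_le_Rintegral.
- exact: bounded_measurableZ.
- apply: bounded_measurableD; last exact: bounded_measurable_cst.
  by apply: bounded_measurableB => //; exact: bounded_measurableZ.
move=> x.
(* Here [ln tilt] is [lam * rho] minus the logarithm of [mgf]. The difference of [v] and [tilt] is
   added at no cost, as both average to 1 under [Q]; each summand is then the bound of [xlnx_le]. *)
have FE : F x = \sum_j Q j * (v j x * ln (tilt lam j x) + (v j x - tilt lam j x)
                 + c^-1 ^+ 3 * e ^+ 2).
  transitivity (lam * (\sum_j Q j * v j x * rho x (a j))
     - ln (mgf a rho Q lam x) * (\sum_j Q j * v j x)
     + (\sum_j Q j * v j x - \sum_j Q j * tilt lam j x)
     + c^-1 ^+ 3 * e ^+ 2 * (\sum_j Q j)).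
    by rewrite Qv sum_tilt Q_pmf.2 subrr addr0 !mulr1.
  rewrite !mulr_sumr -!sumrB -!big_split/=; apply: eq_bigr => j _.
  rewrite {2}/tilt ln_div ?posrE ?expR_gt0 ?mgf_gt0// expRK; ring.
rewrite FE mulr_sumr; apply: ler_sum => j _.
have -> : ln 2 * (Q j * v j x * log2 (v j x)) = Q j * (v j x * ln (v j x)).
  by rewrite /log2; field; rewrite gt_eqF.
apply: ler_wpM2l; first exact: Q_pmf.1.
apply: le_trans (xlnx_le (tilt_gt0 j x) (v_gt0 j x)) _; rewrite lerD2l.
have -> : v j x - tilt lam j x = e * (1 - tilt lam j x) by rewrite vE addrAC subrr add0r.
rewrite exprMn -mulrA mulrC ler_wpM2r ?sqr_ge0//.
rewrite [c^-1 ^+ 3]exprSr; apply: ler_pM; rewrite ?sqr_ge0//.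
  by rewrite invr_ge0 ltW.
  by rewrite -[leLHS]real_normK ?num_real// lerXn2r ?nnegrE ?w1// ltW.
by rewrite lef_pV2 ?posrE.
Qed.

End tilted_channel.

(** * Strictly convex functions lying locally below a parabola *)

(** If [phi x < phi D], then going from [D] away from [x] by [e * L], convexity forces a rise of
    more than [e * gap], while the parabola allows only [C * (e * L) ^+ 2], which is smaller for
    small [e]. *)
Lemma strictly_convex_tangent_min (R : realType) (b D C r : R) (phi : R -> R) :
  strictly_convex_on `]0, b[ phi -> 0 < D < b -> 0 < r -> 0 < C ->
  (forall x : R, `|x| <= r -> phi (D + x) <= phi D + C * x ^+ 2) ->
  forall x : R, 0 < x < b -> phi D <= phi x.
Proof.
move=> phi_cvx /andP[D0 Db] r0 C0 phi_D x /andP[x0 xb].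
rewrite leNgt; apply/negP => phi_x.
pose L := x - D; pose gap := phi D - phi x.
have gap0 : 0 < gap by rewrite /gap subr_gt0.
have L0 : L != 0 by rewrite /L subr_eq0; apply: contraTneq phi_x => ->; rewrite ltxx.
(* A radius within which the parabola bound holds and the interval is not left. *)
pose rho := Num.min r (Num.min (D / 2) ((b - D) / 2)).
have rho0 : 0 < rho by rewrite /rho !lt_min r0 !divr_gt0// subr_gt0.
have nL0 : 0 < `|L| by rewrite normr_gt0.
have CL0 : 0 < C * L ^+ 2 by rewrite mulr_gt0// exprn_even_gt0.
pose e := Num.min (rho / `|L|) (gap / (2 * (C * L ^+ 2))).
have e0 : 0 < e by rewrite /e lt_min !divr_gt0// mulr_gt0.
have eL : `|- (e * L)| <= rho.
  by rewrite normrN normrM gtr0_norm// -ler_pdivlMr// /e ge_min lexx.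
have eC : e * (C * L ^+ 2) <= gap / 2.
  rewrite -ler_pdivlMr// (_ : gap / 2 / _ = gap / (2 * (C * L ^+ 2))).
    by rewrite /e ge_min lexx orbT.
  by rewrite -mulrA -invfM.
have h1 : phi (D - e * L) <= phi D + e ^+ 2 * (C * L ^+ 2).
  have := phi_D (- (e * L)); rewrite sqrrN exprMn mulrCA; apply.
  by apply: le_trans eL _; rewrite /rho ge_min lexx.
have [y1 y2] : 0 < D - e * L /\ D - e * L < b.
  have l1 : rho <= D / 2 by rewrite /rho !ge_min lexx !orbT.
  have l2 : rho <= (b - D) / 2 by rewrite /rho !ge_min lexx !orbT.
  by move: eL; rewrite ler_norml => /andP[]; move: (e * L) => u ? ?; split; lra.
(* The weight that writes [D] as a convex combination of [D - e * L] and [x]. *)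
have t01 : 0 < (1 + e)^-1 < 1.
  by rewrite invr_gt0 addr_gt0//= invf_lt1 ?addr_gt0// ltrDl.
have e1 : 1 + e != 0 by rewrite gt_eqF// addr_gt0.
have yx : D - e * L != x.
  rewrite -subr_eq0 (_ : _ - x = - ((1 + e) * L)); last by rewrite /L; ring.
  by rewrite oppr_eq0 mulf_neq0.
have yb : (`]0, b[%classic : set R) (D - e * L) by rewrite /= in_itv/= y1.
have xb' : (`]0, b[%classic : set R) x by rewrite /= in_itv/= x0.
have := phi_cvx _ _ _ yb xb' yx t01.
have -> : (1 + e)^-1 * (D - e * L) + (1 - (1 + e)^-1) * x = D by rewrite /L; field.
have -> : (1 + e)^-1 * phi (D - e * L) + (1 - (1 + e)^-1) * phi x =
   (phi (D - e * L) + e * phi x) / (1 + e) by field.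
rewrite ltr_pdivlMr ?addr_gt0// => h2.
have : e * gap < e * (e * (C * L ^+ 2)).
  by rewrite /gap mulrA -expr2; move: h1 h2; move: (e ^+ 2 * _) (phi _) (phi _) (phi _) => *; lra.
rewrite ltr_pM2l// => h3; lra.
Qed.

(** After subtraction of the line of slope [s] both points are minimizers of a strictly convex
    function, which would be smaller at their midpoint. *)
Lemma strictly_convex_slope_inj (R : realType) (b s : R) (f : R -> R) (D1 D2 : R) :
  strictly_convex_on `]0, b[ f -> 0 < D1 < b -> 0 < D2 < b -> D1 != D2 ->
  (forall D, D = D1 \/ D = D2 -> exists2 C : R, 0 < C & exists2 r : R, 0 < r &
     forall x : R, `|x| <= r -> f (D + x) <= f D + s * x + C * x ^+ 2) ->
  False.
Proof.
move=> f_cvx D1b D2b D12 f_D.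
pose phi x := f x - s * x.
have phi_cvx : strictly_convex_on `]0, b[ phi.
  move=> x y t xb yb xy t01; rewrite /phi.
  have := f_cvx x y t xb yb xy t01; move: (f _) (f _) (f _) => u v w ?; lra.
have phi_min D : D = D1 \/ D = D2 -> forall x : R, 0 < x < b -> phi D <= phi x.
  move=> DD; have Db : 0 < D < b by case: DD => ->.
  have [C C0 [r r0 fC]] := f_D _ DD.
  apply: (strictly_convex_tangent_min phi_cvx Db r0 C0) => x xr.
  by rewrite /phi; have := fC x xr; move: (f _) (f _) (C * _) => u v w ?; lra.
have phiE : phi D1 = phi D2.
  by apply/eqP; rewrite eq_le phi_min ?phi_min//; [right|left].
have half : 0 < (2^-1 : R) < 1 by rewrite invr_gt0 ltr0n invf_lt1 ?ltr1n ?ltr0n.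
have D1i : (`]0, b[%classic : set R) D1 by rewrite /= in_itv.
have D2i : (`]0, b[%classic : set R) D2 by rewrite /= in_itv.
have := phi_cvx D1 D2 2^-1 D1i D2i D12 half.
have mb : 0 < 2^-1 * D1 + (1 - 2^-1) * D2 < b.
  have /andP[p1 p2] := D1b; have /andP[q1 q2] := D2b.
  by apply/andP; split; lra.
have := phi_min _ (or_introl erefl) _ mb; rewrite -phiE.
by move: (phi _) (phi _) => u v; lra.
Qed.

(** * From almost sure vanishing to a singular matrix *)

(** Otherwise [F] is nonzero on a ball inside [I]. The ball is [P]-null, so the positive density
    integrates to 0 over it and the ball would be Lebesgue-null. *)
Lemma ac_component_null_eq0 (R : realType) (P : probability (measurableTypeR R) R)
    (I : set R) (g F : R -> R) :
  ac_component P I g -> open I -> (forall x, I x -> 0 < g x) ->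
  measurable_fun [set: measurableTypeR R] (F : measurableTypeR R -> R) ->
  P [set x | F x != 0] = 0%E ->
  (forall x, I x -> {for x, continuous F}) ->
  forall x, I x -> F x = 0.
Proof.
move=> [mg [nu PE]] oI g0 mF P0 cF x Ix; apply/eqP/negPn/negP => Fx.
have : \forall y \near x, I y /\ F y != 0.
  near=> y; split; near: y; first exact: open_nbhs_nbhs.
  exact: (cvgr_neq0 (F x) (cF x Ix) Fx).
move=> /nbhs_ballP[e /= e0 xe].
set B : set (measurableTypeR R) := ball x e.
have mB : measurable B by exact: measurable_ball.
have BI : B `<=` I by move=> y /xe[].
have mN := measurable_neq0 mF.
have PB : P B = 0%E.
  by apply: (subset_measure0 mB mN _ P0) => y /xe[].
have mgB : measurable_fun B (fun y => (g y)%:E).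
  by apply/measurable_EFinP; apply: measurable_funS BI mg; exact: open_measurable.
have gB0 y : B y -> (0 <= (g y)%:E)%E by move=> /BI/g0/ltW; rewrite lee_fin.
have intg : (\int[lebesgue_measure]_(y in B) (g y)%:E = 0)%E.
  apply/eqP; rewrite eq_le integral_ge0// andbT -PB PE//.
  by rewrite leeDl.
have : ae_eq (@lebesgue_measure R) B (EFin \o g) (cst 0%E).
  apply/ae_eq_integral_abs => //; rewrite -[RHS]intg; apply: eq_integral => y.
  by rewrite inE => /gB0 ?; rewrite gee0_abs.
move=> [N [mN' N0 BN]].
have : (@lebesgue_measure R) B = 0%E.
  apply: (subset_measure0 mB mN' _ N0) => y By; apply: BN => /(_ By) /= [gy].
  by have := g0 y (BI _ By); rewrite gy ltxx.
rewrite /B lebesgue_measure_ball ?ltW// => -[] /eqP.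
by rewrite mulrn_eq0/= gt_eqF.
Unshelve. all: by end_near. Qed.

Section constant_mgf.
Context (R : realType) (k : nat).
Local Notation RR := (measurableTypeR R).
Variables (a : 'I_k -> R) (rho : R -> R -> R).

Lemma perm_sum_neq (x : 'I_k.+1 -> R) :
  (forall i j, i != j -> j != ord0 -> r_ a rho j (x i) < r_ a rho j (x j)) ->
  forall s : 'S_k.+1, s != 1%g ->
    \sum_j r_ a rho j (x j) != \sum_j r_ a rho j (x (s j)).
Proof.
move=> x_max s s1.
have le j : r_ a rho j (x (s j)) <= r_ a rho j (x j).
  have [->|sj] := eqVneq (s j) j; first exact: lexx.
  have [->|j0] := eqVneq j ord0; last by rewrite ltW// x_max.
  by rewrite /r_ unlift_none.
have [j j0 sj] : exists2 j, j != ord0 & s j != j.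
  apply: contrapT => fix_s; move/negP: s1; apply; apply/eqP/permP.
  have fixed j : j != ord0 -> s j = j.
    by move=> j0; apply/eqP/negPn/negP => sj; apply: fix_s; exists j.
  move=> j; rewrite perm1; have [->|] := eqVneq j ord0; last exact: fixed.
  by apply/eqP/negPn/negP => /[dup] h /fixed/perm_inj e; rewrite e eqxx in h.
rewrite gt_eqF// (bigD1 j)//= [ltRHS](bigD1 j)//= ltr_leD// ?x_max//.
exact: ler_sum.
Qed.

(** Row 0 is constantly 1 as [r_0 = 0], so the row vector with entries [- c] and then [Q] lies in
    the left kernel; it is nonzero because [Q] sums to 1. *)
Lemma det_constant_mgf (Q : 'I_k -> R) (l c : R) (x : 'I_k.+1 -> R) :
  is_pmf Q -> (forall i, mgf a rho Q l (x i) = c) ->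
  \det (\matrix_(j, i) expR (l * r_ a rho j (x i))) = 0.
Proof.
move=> Q_pmf mgfc; apply/eqP/det0P.
pose v : 'rV[R]_k.+1 := \row_j (if unlift ord0 j is Some i then Q i else - c).
have v_lift i : v 0 (lift ord0 i) = Q i by rewrite mxE liftK.
exists v.
  apply/eqP => v0; have /eqP : \sum_j Q j = 0.
    by rewrite big1// => j _; rewrite -v_lift v0 mxE.
  by rewrite Q_pmf.2 oner_eq0.
apply/rowP => i; rewrite !mxE big_ord_recl.
rewrite !mxE unlift_none /r_ unlift_none mulr0 expR0 mulr1.
under eq_bigr do rewrite v_lift !mxE liftK.
by rewrite -/(mgf a rho Q l (x i)) mgfc addNr.
Qed.

Lemma continuous_mgf (Q : 'I_k -> R) (l x : R) :
  (forall j, {for x, continuous (fun y => rho y (a j))}) ->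
  {for x, continuous (mgf a rho Q l)}.
Proof.
move=> crho; suff : mgf a rho Q l y @[y --> x] --> mgf a rho Q l x by [].
rewrite /mgf; elim: (index_enum _) => [|j s ih].
  by rewrite big_nil; under eq_fun do rewrite big_nil; exact: cvg_cst.
rewrite big_cons; under eq_fun do rewrite big_cons.
apply: cvgD => //; apply: cvgM; first exact: cvg_cst.
apply: (@cvg_comp _ _ _ (fun y => l * rho y (a j)) expR); last exact: continuous_expR.
by apply: cvgM; [exact: cvg_cst|exact: crho].
Qed.

End constant_mgf.

(** * Consequences of the vanishing of [f_D] *)

Section zero_level.
Context (R : realType) (k : nat).
Local Notation RR := (measurableTypeR R).
Variables (a : 'I_k -> R) (M : R) (rho : R -> R -> R) (P : probability RR R).
Hypothesis rho_bounded : forall x j, 0 <= rho x (a j) <= M.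
Hypothesis rho_measurable : forall j,
  measurable_fun [set: RR] (fun x : RR => (rho x (a j) : RR)).
Variables (Q : 'I_k -> R) (lam D : R).
Hypotheses (Q_pmf : is_pmf Q) (lam_le0 : lam <= 0).

Let log2e : log2 (expR 1) = (ln 2)^-1 :> R.
Proof. by rewrite /log2 expRK mul1r. Qed.

Let ln2_gt0 : 0 < ln 2 :> R. Proof. by rewrite ln_gt0// ltr1n. Qed.

Lemma bounded_measurable_f_D :
  bounded_measurable (fun x : RR => f_D P a rho Q lam D x).
Proof.
apply: bounded_measurableB; last exact: bounded_measurable_cst.
apply: bounded_measurableZ; apply: bounded_measurableB.
  exact: bounded_measurable_cst.
exact (bounded_measurable_ln_mgf rho_bounded rho_measurable Q_pmf lam_le0).
Qed.

Lemma f_D_eq0 x : f_D P a rho Q lam D x = 0 ->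
  mgf a rho Q lam x = expR (lam * D - ln 2 * RD P a rho D).
Proof.
rewrite /f_D log2e => f0.
have -> : lam * D - ln 2 * RD P a rho D = ln (mgf a rho Q lam x).
  have : ln 2 * ((ln 2)^-1 * (lam * D - ln (mgf a rho Q lam x)) - RD P a rho D) = 0.
    by rewrite f0 mulr0.
  by rewrite mulrBr mulVKf ?gt_eqF// => h; lra.
by rewrite lnK// posrE; exact (mgf_gt0 rho_bounded Q_pmf _ lam_le0).
Qed.

Lemma continuous_f_D x :
  (forall j, {for x, continuous (fun y => rho y (a j))}) ->
  {for x, continuous (f_D P a rho Q lam D)}.
Proof.
move=> crho.
suff : f_D P a rho Q lam D y @[y --> x] --> f_D P a rho Q lam D x by [].
rewrite /f_D.
apply: cvgB; last exact: cvg_cst.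
apply: cvgM; first exact: cvg_cst.
apply: cvgB; first exact: cvg_cst.
have c1 := continuous_mgf (Q := Q) (l := lam) crho.
have c2 := continuous_ln (mgf_gt0 rho_bounded Q_pmf x lam_le0).
exact (continuous_comp c1 c2).
Qed.

(** Integration of [f_D] against [P]. It turns the constant term of [RD_variation] into the value of
    the rate-distortion function at [D]. *)
Lemma RD_of_null : P [set x | f_D P a rho Q lam D x != 0] = 0%E ->
  lam * D - Lambda P a rho Q lam = ln 2 * RD P a rho D.
Proof.
move=> f0; have bf := bounded_measurable_f_D.
have if0 : \int[P]_x f_D P a rho Q lam D x = 0.
  rewrite /Rintegral (ae_eq_integral (cst 0%E))//.
  - by rewrite integral0.
  - by apply/measurable_EFinP; exact: bf.1.
  exists [set x | f_D P a rho Q lam D x != 0]; split=> //.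
    exact (measurable_neq0 bf.1).
  by move=> x /= h; apply/eqP => e; apply: h => _; rewrite e.
have blm := bounded_measurable_ln_mgf rho_bounded rho_measurable Q_pmf lam_le0.
move: if0; rewrite /f_D log2e bm_RintegralB; last 2 first.
- apply: bounded_measurableZ; apply: bounded_measurableB => //.
  exact: bounded_measurable_cst.
- exact: bounded_measurable_cst.
rewrite bm_RintegralZ; last first.
  by apply: bounded_measurableB => //; exact: bounded_measurable_cst.
rewrite bm_RintegralB//; last exact: bounded_measurable_cst.
rewrite !Rintegral_prob_cst -/(Lambda P a rho Q lam) => h.
by apply: (mulfI (lt0r_neq0 (_ : 0 < (ln 2)^-1 :> R))); rewrite ?invr_gt0// mulKf ?gt_eqF//; lra.
Qed.

(** The right side is a [Q]-average of numbers whose minimum is [Dmax]. Hence the product channel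
    has distortion above [D], and mixing it in really moves the distortion. *)
Lemma Dmax_le_product : Dmax P a rho <= \int[P]_x (\sum_j Q j * rho x (a j)).
Proof.
have brho j := bounded_measurable_rho rho_bounded rho_measurable j.
rewrite (@bm_Rintegral_sum _ _ _ P _ _ (fun j (x : RR) => Q j * rho x (a j))); last first.
  by move=> j; exact: bounded_measurableZ.
rewrite -[leLHS]mul1r -Q_pmf.2 mulr_suml; apply: ler_sum => j _.
rewrite (bm_RintegralZ P (Q j) (brho j)) ler_wpM2l ?Q_pmf.1//.
apply: ge_inf; last by exists j.
exists 0 => _ [i _ <-]; apply: Rintegral_ge0 => x _.
by have /andP[] := rho_bounded x i.
Qed.

End zero_level.

Theorem corollary2 (R : realType) (k : nat) (hk : (0 < k)%N)
    (a : 'I_k -> R) (a_inj : injective a)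
    (M : R) (rho : R -> R -> R)
    (rho_bounded : forall x j, 0 <= rho x (a j) <= M)
    (rho_measurable : forall j,
       measurable_fun [set: measurableTypeR R]
         (fun x : measurableTypeR R => (rho x (a j) : measurableTypeR R)))
    (rho_sup : sup (range (min_distortion a rho)) = 0)
    (P : probability (measurableTypeR R) R)
    (Dmax_gt0 : 0 < Dmax P a rho)
    (I : set R) (I_nonempty : I !=set0) (I_open : open I)
    (I_interval : is_interval I)
    (g : R -> R) (g_ac : ac_component P I g)
    (g_gt0 : forall x, I x -> 0 < g x)
    (r_continuous : forall j, {within I, continuous (r_ a rho j)})
    (d : measure_display) (Omega : measurableType d) (Pr : probability Omega R)
    (X1 : {RV Pr >-> measurableTypeR R})
    (X1_law : forall B : set (measurableTypeR R),
       measurable B -> distribution Pr X1 B = P B)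
    (Qstar : R -> 'I_k -> R) (lamstar : R -> R)
    (star_optimal : forall D, 0 < D < Dmax P a rho ->
       optimal_pair P a rho D (Qstar D) (lamstar D))
    (RD_diff : forall D, 0 < D < Dmax P a rho -> derivable (RD P a rho) D 1)
    (RD_convex : strictly_convex_on `]0, Dmax P a rho[ (RD P a rho))
    (H : (exists x : 'I_k.+1 -> R,
            [/\ injective x, forall i, I (x i) &
                forall i j : 'I_k.+1, i != j -> j != ord0 ->
                  r_ a rho j (x i) < r_ a rho j (x j)])
         \/
         (exists x : 'I_k.+1 -> R,
            [/\ injective x, forall i, I (x i) &
                forall s : 'S_k.+1, s != 1%g ->
                  \sum_j r_ a rho j (x j) != \sum_j r_ a rho j (x (s j))])) :
  finite_set [set D : R | 0 < D < Dmax P a rho /\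
    {ae Pr, forall w, f_D P a rho (Qstar D) (lamstar D) D (X1 w) = 0}].
Proof.
have [x xI x_perm] : exists2 x : 'I_k.+1 -> R, forall i, I (x i) &
    forall s : 'S_k.+1, s != 1%g ->
      \sum_j r_ a rho j (x j) != \sum_j r_ a rho j (x (s j)).
  case: H => -[x [_ xI hx]]; exists x => //.
  by apply: perm_sum_neq => i j; exact: hx.
set B := [set D : R | _].
have crho y j : I y -> {for y, continuous (fun z => rho z (a j))}.
  move=> Iy; have := r_continuous (lift ord0 j).
  rewrite continuous_open_subspace// => /(_ y); rewrite inE => /(_ Iy).
  rewrite (_ : r_ a rho (lift ord0 j) = fun z => rho z (a j))//.
  by apply/funext => z; rewrite /r_ liftK.
have null D : B D -> P [set y | f_D P a rho (Qstar D) (lamstar D) D y != 0] = 0%E.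
  move=> [D_in [N [mN N0 fN]]]; have [Q_pmf _ lam0 _] := star_optimal _ D_in.
  have bf := bounded_measurable_f_D P rho_bounded rho_measurable D Q_pmf (ltW lam0).
  have mF := measurable_neq0 bf.1.
  rewrite -X1_law//; apply: (subset_measure0 _ mN _ N0).
    by rewrite -[X in measurable X]setTI; exact: measurable_funP.
  by move=> w /= /eqP fw; apply: fN.
have B_lam D : B D -> lamstar D \in
    [set l | \det (\matrix_(j, i) expR (l * r_ a rho j (x i))) = 0].
  move=> BD; have D_in := BD.1; have [Q_pmf _ lam0 _] := star_optimal _ D_in.
  rewrite inE /=; apply: (det_constant_mgf Q_pmf) => i.
  apply: (f_D_eq0 rho_bounded Q_pmf (ltW lam0)).
  apply: (ac_component_null_eq0 g_ac I_open g_gt0 _ (null _ BD)) => //.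
    by have [] := bounded_measurable_f_D P rho_bounded rho_measurable D Q_pmf (ltW lam0).
  move=> y Iy.
  exact (@continuous_f_D _ _ _ _ _ P rho_bounded _ _ D Q_pmf (ltW lam0) _
    (fun j => crho y j Iy)).
have slope D : B D -> exists2 C : R, 0 < C & exists2 r : R, 0 < r &
    forall y : R, `|y| <= r -> ln 2 * RD P a rho (D + y) <=
      ln 2 * RD P a rho D + lamstar D * y + C * y ^+ 2.
  move=> BD; have D_in := BD.1; have [Q_pmf _ lam0 dL] := star_optimal _ D_in.
  have [C C0 [e0 e0_gt0 RDe]] :=
    RD_variation a_inj rho_bounded rho_measurable Q_pmf (ltW lam0) lam0 dL.
  move: RDe; set d' := _ - D => RDe.
  have d0 : 0 < d'.
    rewrite subr_gt0; have /andP[_ DDmax] := D_in; apply: (lt_le_trans DDmax).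
    exact (Dmax_le_product P rho_bounded rho_measurable Q_pmf).
  (* A mixing weight [e] moves the distortion by [e * d']; the constant and the radius come from
     substituting [e = y / d']. *)
  exists (C / d' ^+ 2); first by rewrite divr_gt0// exprn_gt0.
  exists (e0 * d'); first by rewrite mulr_gt0.
  move=> y yr; have := RDe (y / d'); rewrite normrM normfV (gtr0_norm d0).
  rewrite ler_pdivrMr// => /(_ yr) /=; rewrite divfK ?gt_eqF//.
  rewrite (RD_of_null rho_bounded rho_measurable Q_pmf (ltW lam0) (null _ BD)).
  by rewrite expr_div_n mulrA [_ * _ / _]mulrAC.
have lam_inj : {in B &, injective lamstar}.
  move=> D1 D2; rewrite !inE => BD1 BD2 lam12; apply/eqP/negPn/negP => D12.
  have ln20 : 0 < ln 2 :> R by rewrite ln_gt0// ltr1n.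
  apply: (@strictly_convex_slope_inj R (Dmax P a rho) (lamstar D1)
    (fun y => ln 2 * RD P a rho y) D1 D2) => //; [|exact: BD1.1|exact: BD2.1|].
    move=> u v t u_in v_in uv t01; have := RD_convex u v t u_in v_in uv t01.
    by rewrite -(ltr_pM2l ln20) mulrDr !(mulrCA (ln 2)).
  by move=> D [->|->]; [exact: slope|rewrite lam12; exact: slope].
(* [B] is equipotent to its image under [lamstar], which consists of zeros of the determinant. *)
rewrite -(eq_finite_set (inj_card_eq lam_inj)).
apply: sub_finite_set (finite_zeros_exp_det _).
  by move=> _ [D BD <-]; apply/set_mem; exact: B_lam.
exact: x_perm.
Qed.
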